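(* Let $(M,g)$ be a space-time, $V$ a globally defined time-like vector field on $M$, and $\alpha,\beta$ real-valued functions on $M$ with $\alpha>0$ and $\alpha+\beta>0$ everywhere. Let $$\widehat{g}(Y,Z)=\alpha\, g(Y,Z)+\frac{\beta}{g(V,V)}\,g(V,Y)\,g(V,Z)$$ be the corresponding disformal metric. Let $p\in M$ and let $X\in T_pM$ be a null-like vector with respect to $\widehat{g}$. Then: (1) if $\beta(p)=0$, then $X$ is also null-like with respect to $g$, and the light cone of $\widehat{g}$ at $p$ is the same as the light cone of $g$ at $p$; (2) if $\beta(p)<0$, then $X$ is time-like with respect to $g$, and the light cone of $\widehat{g}$ at $p$ lies inside the light cone of $g$ at $p$; (3) if $\beta(p)>0$, then $X$ is space-like with respect to $g$, and the light cone of $g$ at $p$ lies inside the light cone of $\widehat{g}$ at $p$.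
   Context: A space-time $(M,g)$ is a smooth, time-orientable four-dimensional manifold with a Lorentzian metric $g$ of signature $(+,-,-,-)$. With respect to a Lorentzian metric $k$ of this signature, a nonzero vector $X\in T_pM$ is time-like if $k(X,X)>0$, null-like if $k(X,X)=0$, and space-like if $k(X,X)<0$. The light cone of $k$ at $p$ is the set of null-like vectors of $k$ in $T_pM$; the light cone of $k_1$ at $p$ is said to lie inside that of $k_2$ if the region it bounds is contained in that of the other, i.e. $\{X\in T_pM: k_1(X,X)\ge 0\}\subseteq\{X\in T_pM: k_2(X,X)\ge 0\}$. The conditions $\alpha>0$, $\alpha+\beta>0$ ensure that $\widehat{g}$ is a Lorentzian metric of the same signature as $g$. *)

(* Defs.v *)
From HB Require Import structures.
From mathcomp Require Import all_boot all_order all_algebra.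
From mathcomp Require Import all_classical all_reals all_analysis.

Set Implicit Arguments.
Unset Strict Implicit.
Unset Printing Implicit Defensive.

Import Order.TTheory GRing.Theory Num.Theory.
Import numFieldNormedType.Exports.

Local Open Scope classical_set_scope.
Local Open Scope ring_scope.

(* C^k and smooth maps on a subset U of R^n; only used with U open, where it
   only depends on the values of f on U: a function is C^(k+1) when it is
   continuous and its partial derivatives exist and are C^k. *)
Fixpoint Ck_on (R : realType) (n : nat) (W : normedModType R) (k : nat)
    (U : set 'rV[R]_n) (f : 'rV[R]_n -> W) : Prop :=
  (forall x, U x -> {for x, continuous f}) /\
  match k with
  | 0 => True
  | k'.+1 => forall i : 'I_n,
      (forall x, U x -> derivable f x (delta_mx 0 i)) /\
      Ck_on k' U (fun x => 'D_(delta_mx 0 i) f x)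
  end.

Definition smooth_on (R : realType) (n : nat) (W : normedModType R)
    (U : set 'rV[R]_n) (f : 'rV[R]_n -> W) : Prop :=
  forall k, Ck_on k U f.

(* Outside chart_dom and chart_cod the two total maps are irrelevant. *)
Record chart (R : realType) (n : nat) (T : topologicalType) := Chart {
  chart_dom : set T;
  chart_cod : set 'rV[R]_n;
  chart_fun : T -> 'rV[R]_n;
  chart_inv : 'rV[R]_n -> T;
  chart_dom_open : open chart_dom;
  chart_cod_open : open chart_cod;
  chart_funS : forall x, chart_dom x -> chart_cod (chart_fun x);
  chart_invS : forall y, chart_cod y -> chart_dom (chart_inv y);
  chart_funK : forall x, chart_dom x -> chart_inv (chart_fun x) = x;
  chart_invK : forall y, chart_cod y -> chart_fun (chart_inv y) = y;
  chart_fun_continuous :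
    forall x, chart_dom x -> {for x, continuous chart_fun};
  chart_inv_continuous :
    forall y, chart_cod y -> {for y, continuous chart_inv} }.

(* The atlas need not be maximal: every smooth atlas lies in a unique maximal
   one, which has the same smooth functions. *)
Record smooth_manifold (R : realType) (n : nat) := SmoothManifold {
  manifold_carrier :> topologicalType;
  manifold_hausdorff : hausdorff_space manifold_carrier;
  manifold_second_countable : @second_countable manifold_carrier;
  atlas : set (chart R n manifold_carrier);
  atlas_cover : forall x, exists2 c, atlas c & chart_dom c x;
  atlas_smooth : forall c d, atlas c -> atlas d ->
    smooth_on (chart_cod c `&` chart_inv c @^-1` chart_dom d)
              (chart_fun d \o chart_inv c) }.

Definition smooth_fun (R : realType) (n : nat) (M : smooth_manifold R n)
    (f : M -> R) : Prop :=
  forall c, atlas c ->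
    smooth_on (chart_cod c) (f \o chart_inv c : 'rV[R]_n -> R^o).

(* Tangent vectors at p are the derivations at p of the algebra of smooth
   functions on M.  They are encoded as functionals on all functions M -> R,
   with the value 0 on the functions that are not smooth, so that two of them
   are equal as soon as they agree on smooth functions. *)
Definition is_derivation (R : realType) (n : nat) (M : smooth_manifold R n)
    (p : M) (D : (M -> R) -> R) : Prop :=
  [/\ forall (a : R) f g, smooth_fun f -> smooth_fun g ->
        D (fun x => a * f x + g x) = a * D f + D g,
      forall f g, smooth_fun f -> smooth_fun g ->
        D (fun x => f x * g x) = D f * g p + f p * D g
    & forall f, ~ smooth_fun f -> D f = 0 ].

Definition derivations (R : realType) (n : nat) (M : smooth_manifold R n)
    (p : M) : {pred ((M -> R) -> R^o)} :=
  [pred D | `[< is_derivation p D >]].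

Record tangent (R : realType) (n : nat) (M : smooth_manifold R n) (p : M) :=
  Tangent { tangent_val :> (M -> R) -> R^o;
            tangentP : tangent_val \in derivations p }.

Section TangentSpace.
Variables (R : realType) (n : nat) (M : smooth_manifold R n) (p : M).

Fact derivations_submod_closed : submod_closed (derivations p).
Proof.
split.
  by apply/asboolP; split => *; rewrite /GRing.zero /= ?mulr0 ?mul0r ?addr0.
move=> a D E /asboolP[D1 D2 D3] /asboolP[E1 E2 E3]; apply/asboolP.
have HE h : (a *: D + E) h = a * D h + E h by [].
split=> [b f g sf sg|f g sf sg|f nf]; rewrite !HE.
- rewrite D1 // E1 // !mulrDr !mulrA (mulrC b a) -!addrA; congr (_ + _).
  by rewrite addrCA.
- rewrite D2 // E2 // !mulrDr !mulrDl !mulrA (mulrC (f p) a) -!addrA.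
  by congr (_ + _); rewrite addrCA.
- by rewrite D3 // E3 // mulr0 addr0.
Qed.

HB.instance Definition _ :=
  GRing.isSubmodClosed.Build R ((M -> R) -> R^o) (derivations p)
    derivations_submod_closed.

HB.instance Definition _ := [isSub for @tangent_val R n M p].
HB.instance Definition _ := [Choice of tangent p by <:].
HB.instance Definition _ := [SubChoice_isSubLmodule of tangent p by <:].

End TangentSpace.

Notation vector_field M := (forall p : M, tangent p).

Definition smooth_vector_field (R : realType) (n : nat)
    (M : smooth_manifold R n) (V : vector_field M) : Prop :=
  forall f : M -> R, smooth_fun f -> smooth_fun (fun p => V p f).

Definition continuous_vector_field (R : realType) (n : nat)
    (M : smooth_manifold R n) (V : vector_field M) : Prop :=
  forall f : M -> R, smooth_fun f -> continuous (fun p => V p f).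

Definition form_field (R : realType) (n : nat) (M : smooth_manifold R n) :=
  forall p : M, tangent p -> tangent p -> R.

Definition smooth_form_field (R : realType) (n : nat)
    (M : smooth_manifold R n) (k : form_field M) : Prop :=
  forall V W : vector_field M,
    smooth_vector_field V -> smooth_vector_field W ->
    smooth_fun (fun p => k p (V p) (W p)).

(* Signature (+,-,-,-): the tangent space has a k-orthonormal basis e_0,...,e_3
   with k(e_0,e_0) = 1 and k(e_i,e_i) = -1 for i > 0; linear independence of
   the e_i follows from the values of k. *)
Definition lorentz_signature (R : realType) (M : smooth_manifold R 4)
    (k : form_field M) (p : M) : Prop :=
  exists e : 'I_4 -> tangent p,
    (forall X, exists c : 'I_4 -> R, X = \sum_(i < 4) c i *: e i) /\
    (forall i j, k p (e i) (e j) =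
       if i == j then (if i == ord0 then 1 else -1) else 0).

Definition lorentzian_metric (R : realType) (M : smooth_manifold R 4)
    (k : form_field M) : Prop :=
  [/\ smooth_form_field k,
      forall (p : M) (X Y : tangent p), k p X Y = k p Y X,
      forall (p : M) (X : tangent p), scalar (k p X)
    & forall p : M, lorentz_signature k p ].

Definition timelike (R : realType) (M : smooth_manifold R 4)
    (k : form_field M) (p : M) (X : tangent p) : Prop :=
  X != 0 /\ 0 < k p X X.

Definition nulllike (R : realType) (M : smooth_manifold R 4)
    (k : form_field M) (p : M) (X : tangent p) : Prop :=
  X != 0 /\ k p X X = 0.

Definition spacelike (R : realType) (M : smooth_manifold R 4)
    (k : form_field M) (p : M) (X : tangent p) : Prop :=
  X != 0 /\ k p X X < 0.

Definition light_cone (R : realType) (M : smooth_manifold R 4)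
    (k : form_field M) (p : M) : set (tangent p) :=
  [set X | nulllike k X].

Definition light_cone_region (R : realType) (M : smooth_manifold R 4)
    (k : form_field M) (p : M) : set (tangent p) :=
  [set X | 0 <= k p X X].

Arguments light_cone {R M} k p.
Arguments light_cone_region {R M} k p.

Definition light_cone_inside (R : realType) (M : smooth_manifold R 4)
    (p : M) (k1 k2 : form_field M) : Prop :=
  light_cone_region k1 p `<=` light_cone_region k2 p.

Definition timelike_field (R : realType) (M : smooth_manifold R 4)
    (k : form_field M) (V : vector_field M) : Prop :=
  forall p : M, timelike k (V p).

Definition time_orientable (R : realType) (M : smooth_manifold R 4)
    (k : form_field M) : Prop :=
  exists V : vector_field M, continuous_vector_field V /\ timelike_field k V.

Definition spacetime (R : realType) (M : smooth_manifold R 4)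
    (g : form_field M) : Prop :=
  lorentzian_metric g /\ time_orientable g.

Definition disformal (R : realType) (M : smooth_manifold R 4)
    (g : form_field M) (V : vector_field M) (alpha beta : M -> R) :
    form_field M :=
  fun p Y Z => alpha p * g p Y Z +
    beta p / g p (V p) (V p) * g p (V p) Y * g p (V p) Z.

(* Main.v *)
(* The disformal metric differs from [alpha * g] on the diagonal by
   [beta * g(V,X)^2 / g(V,V)], whose sign is that of [beta]; this orders the two
   cones.  For the strict inequalities the correction must not vanish on a
   null-like [X]: if [g(V,X) = 0] then [g(X,X) = 0] too, which is impossible
   because [g] is negative definite on the orthogonal complement of a time-like
   vector. *)

From HB Require Import structures.
Require Import Defs.
From mathcomp Require Import all_boot all_order all_algebra.
From mathcomp Require Import all_classical all_reals all_analysis.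
From mathcomp Require Import ring lra.

Import Order.TTheory GRing.Theory Num.Theory.
Import numFieldNormedType.Exports.

Local Open Scope classical_set_scope.
Local Open Scope ring_scope.

(** Cauchy-Schwarz on the spatial parts bounds [(v0 * x0) ^+ 2] by [v * x], hence by [v * x0 ^+ 2].
    Since [v < v0 * v0], this forces [x0 = 0], and then the spatial part of [x] has nonpositive
    square norm. *)
Lemma minkowski_orthogonal_eq0 (R : realDomainType)
    (v0 v1 v2 v3 x0 x1 x2 x3 : R) :
  v1 * v1 + v2 * v2 + v3 * v3 < v0 * v0 ->
  v0 * x0 = v1 * x1 + v2 * x2 + v3 * x3 ->
  x1 * x1 + x2 * x2 + x3 * x3 <= x0 * x0 ->
  [/\ x0 = 0, x1 = 0, x2 = 0 & x3 = 0].
Proof.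
set v := v1 * v1 + _ + _; set x := x1 * x1 + _ + _ => vlt vx xle.
have v_ge0 : 0 <= v by rewrite /v -!expr2 !addr_ge0 ?sqr_ge0.
(* Lagrange's identity: the defect in Cauchy-Schwarz is the sum of the squared 2x2 minors. *)
have lagrange : (v0 * x0) ^+ 2 + ((v1 * x2 - v2 * x1) ^+ 2 +
    (v1 * x3 - v3 * x1) ^+ 2 + (v2 * x3 - v3 * x2) ^+ 2) = v * x.
  by rewrite vx /v /x; ring.
have cs : (v0 * x0) ^+ 2 <= v * x.
  by rewrite -lagrange lerDl !addr_ge0 ?sqr_ge0.
have x0_eq0 : x0 = 0.
  apply/eqP; rewrite -sqrf_eq0 eq_le sqr_ge0 andbT.
  (* Multiplying by this positive factor reduces [x0 ^+ 2 <= 0] to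
     [(v0 * x0) ^+ 2 <= v * x0 ^+ 2]. *)
  have v0v : 0 < v0 * v0 - v by rewrite subr_gt0.
  rewrite -(pmulr_rle0 _ v0v) mulrBl subr_le0 -expr2 -exprMn.
  by apply: le_trans cs _; rewrite expr2 ler_wpM2l.
move: xle; rewrite x0_eq0 mulr0 /x -!expr2 => xle.
have [[s1 s2] s3] := (sqr_ge0 x1, sqr_ge0 x2, sqr_ge0 x3).
by split=> //; apply/eqP; rewrite -sqrf_eq0; apply/eqP; lra.
Qed.

Section LorentzianMetric.
Variables (R : realType) (M : smooth_manifold R 4) (g : form_field M).
Hypothesis hg : lorentzian_metric g.

Lemma metric_suml (p : M) (Y : tangent p) n (c : 'I_n -> R)
    (e : 'I_n -> tangent p) :
  g p (\sum_(i < n) c i *: e i) Y = \sum_(i < n) c i * g p (e i) Y.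
Proof.
case: hg => _ gC glin _; rewrite gC.
(* Linearity is given in the second slot only; symmetry has moved the sum there. *)
pose L : {scalar tangent p} :=
  HB.pack (g p Y) (GRing.isLinear.Build _ _ _ _ _ (glin p Y)).
rewrite -[LHS]/(L _) linear_sum; apply: eq_bigr => i _.
by rewrite linearZ /= [in RHS]gC.
Qed.

Lemma metric_minkowski (p : M) (e : 'I_4 -> tangent p) (c d : 'I_4 -> R) :
  (forall i j, g p (e i) (e j) =
     if i == j then (if i == ord0 then 1 else -1) else 0) ->
  g p (\sum_(i < 4) c i *: e i) (\sum_(j < 4) d j *: e j) =
  \sum_(i < 4) (if i == ord0 then c i * d i else - (c i * d i)).
Proof.
move=> ge; rewrite metric_suml; apply: eq_bigr => i _.
case: (hg) => _ gC _ _; rewrite gC metric_suml (bigD1 i) //= big1 => [|j ji].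
  by rewrite ge eqxx; case: ifP => _; ring.
by rewrite ge (negPf ji) mulr0.
Qed.

(** In an orthonormal basis this becomes a statement about coordinates: if [g p X X] were
    nonnegative, [minkowski_orthogonal_eq0] would make every coordinate of [X] vanish. *)
Lemma timelike_orthogonal_spacelike (p : M) (V X : tangent p) :
  timelike g V -> g p V X = 0 -> X != 0 -> spacelike g X.
Proof.
move=> [_ gVV] gVX X0; split=> //; rewrite ltNge; apply/negP => gXX.
case: (hg) => _ _ _ /(_ p) [e [gen ge]].
have [v Ve] := gen V; have [x Xe] := gen X.
move: gVV gVX gXX X0; rewrite Ve Xe !metric_minkowski //.
rewrite !big_ord_recl !big_ord0 /= => gVV gVX gXX.
set i1 := lift ord0 ord0 in gVV gVX gXX *.
set i2 := lift ord0 (lift ord0 ord0) in gVV gVX gXX *.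
set i3 := lift ord0 (lift ord0 (lift ord0 ord0)) in gVV gVX gXX *.
have [||| -> -> -> ->] := @minkowski_orthogonal_eq0 R
  (v ord0) (v i1) (v i2) (v i3) (x ord0) (x i1) (x i2) (x i3); [lra|lra|lra|].
by rewrite !scale0r !addr0 eqxx.
Qed.

End LorentzianMetric.

Theorem mainTheorem2 (R : realType) (M : smooth_manifold R 4)
    (g : form_field M) (hg : spacetime g)
    (V : vector_field M) (hV : smooth_vector_field V)
    (hVt : timelike_field g V)
    (alpha beta : M -> R)
    (halpha : forall q : M, 0 < alpha q)
    (halphabeta : forall q : M, 0 < alpha q + beta q)
    (p : M) (X : tangent p)
    (hX : nulllike (disformal g V alpha beta) X) :
  [/\ beta p = 0 ->
        nulllike g X /\
        light_cone (disformal g V alpha beta) p = light_cone g p,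
      beta p < 0 ->
        timelike g X /\
        light_cone_inside p (disformal g V alpha beta) g
    & 0 < beta p ->
        spacelike g X /\
        light_cone_inside p g (disformal g V alpha beta) ].
Proof.
have [glor _] := hg.
have hV2 := (hVt p).2; have ap := halpha p.
have ghE (Y : tangent p) : disformal g V alpha beta Y Y =
    alpha p * g p Y Y + beta p * (g p (V p) Y ^+ 2 / g p (V p) (V p)).
  by rewrite /disformal; ring.
have corr_ge0 (Y : tangent p) : 0 <= g p (V p) Y ^+ 2 / g p (V p) (V p).
  by rewrite divr_ge0 ?sqr_ge0 // ltW.
have [X0 gX] := hX.
have corr_gt0 : 0 < g p (V p) X ^+ 2 / g p (V p) (V p).
  rewrite divr_gt0 // lt_def sqr_ge0 andbT sqrf_eq0; apply/eqP => gVX.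
  have [_ gXX] := timelike_orthogonal_spacelike _ _ _ glor _ _ _ (hVt p) gVX X0.
  move: gX; rewrite ghE gVX expr0n /= mul0r mulr0 addr0 => /eqP.
  by rewrite mulf_eq0 gt_eqF //= lt_eqF.
(* As [alpha p] and the quotient are positive, [g p X X] has the sign opposite to [beta p]; this
   classifies [X] in the last two cases. *)
have gXE : alpha p * g p X X =
    - (beta p * (g p (V p) X ^+ 2 / g p (V p) (V p))).
  by apply/eqP; rewrite -addr_eq0 -ghE gX.
split=> hb.
- have nullE (Y : tangent p) : nulllike (disformal g V alpha beta) Y <-> nulllike g Y.
    rewrite /nulllike ghE hb mul0r addr0; split=> -[Y0 gY]; split=> //.
      by apply: (mulfI (lt0r_neq0 ap)); rewrite gY mulr0.
    by rewrite gY mulr0.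
  split; first exact/nullE.
  by apply/seteqP; split=> Y /nullE.
- split.
    split=> //; rewrite -(pmulr_rgt0 _ ap).
    by rewrite gXE oppr_gt0 nmulr_rlt0.
  move=> Y; rewrite /light_cone_region /= ghE => gY.
  (* For [beta p < 0] the correction is nonpositive, so [alpha p * g p Y Y] dominates the disformal
     value. *)
  rewrite -(pmulr_rge0 _ ap); apply: le_trans gY _.
  by rewrite gerDl mulr_le0_ge0 // ltW.
- split.
    split=> //; rewrite -(pmulr_rlt0 _ ap).
    by rewrite gXE oppr_lt0 mulr_gt0.
  move=> Y; rewrite /light_cone_region /= ghE => gY.
  by rewrite addr_ge0 // mulr_ge0 // ltW.
Qed.
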